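(* For every $N$, the discrete KMP model, i.e. the Markov process on $\mathbb{N}_0^{\mathbb{T}_N}$ with generator $$L_N^{\mathrm{dKMP}}f(\eta)=\sum_{x\in\mathbb{T}_N}\frac1{\eta_x+\eta_{x+1}+1}\sum_{r=0}^{\eta_x+\eta_{x+1}}\big[f(\eta^{(x,r)})-f(\eta)\big],$$ is attractive.
   Context: $\mathbb{N}_0=\{0,1,\dots\}$; for an integer $N\ge2$, $\mathbb{T}_N=\mathbb{Z}/N\mathbb{Z}\cong\{0,\dots,N-1\}$ is the discrete torus. $\eta^{(x,r)}$ is the configuration obtained from $\eta\in\mathbb{N}_0^{\mathbb{T}_N}$ by replacing $\eta_x$ by $r$ and $\eta_{x+1}$ by $\eta_x+\eta_{x+1}-r$, leaving all other coordinates unchanged. Equivalently, for each ordered pair of neighbours $(x,y)$ and each $k\ge1$, $k$ particles jump from $x$ to $y$ at rate $\frac1{\eta_x+\eta_y+1}\mathbf{1}_{\{k\le\eta_x\}}$. A function $f$ on the configuration space is monotone if $f(\eta)\le f(\xi)$ whenever $\eta_x\le\xi_x$ for all $x\in\mathbb{T}_N$. For probability measures $\mu_1,\mu_2$ on the configuration space, $\mu_1\le\mu_2$ means $E_{\mu_1}[f]\le E_{\mu_2}[f]$ for every bounded monotone $f$. A process with Markov semigroup $\{S(t):t\ge0\}$ is called attractive if for all probability measures $\mu_1\le\mu_2$ on the configuration space one has $S(t)\mu_1\le S(t)\mu_2$ for all $t\ge0$, where $S(t)\mu$ denotes the law at time $t$ of the process started from $\mu$. *)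

(* Defs.v *)
From HB Require Import structures.
From mathcomp Require Import all_boot all_order all_algebra.
From mathcomp Require Import all_classical all_reals all_analysis.

Set Implicit Arguments.
Unset Strict Implicit.
Unset Printing Implicit Defensive.

Import Order.TTheory GRing.Theory Num.Theory.
Import numFieldNormedType.Exports.

Local Open Scope classical_set_scope.
Local Open Scope ring_scope.

(* The torus Z/NZ is 'Z_N, which has N elements only when 1 < N. *)
Definition config (N : nat) := {ffun 'Z_N -> nat}.

HB.instance Definition _ N := Choice.copy (config N) {ffun 'Z_N -> nat}.
HB.instance Definition _ N :=
  isPointed.Build (config N) ([ffun=> 0%N] : {ffun 'Z_N -> nat}).

(* The configuration space is countable; every set of configurations is
   measurable, so that every real function on it is a random variable. *)
HB.instance Definition _ N := @isMeasurable.Build default_measure_display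
  (config N) discrete_measurable discrete_measurable0
  discrete_measurableC discrete_measurableU.

Definition redistribute N (eta : config N) (x : 'Z_N) (r : nat) : config N :=
  [ffun z => if z == x then r
             else if z == x + 1 then (eta x + eta (x + 1)%R - r)%N
             else eta z].

Definition dKMP_generator (R : realType) N (f : config N -> R)
    (eta : config N) : R :=
  \sum_(x : 'Z_N) ((eta x + eta (x + 1)%R).+1)%:R^-1 *
    \sum_(r < (eta x + eta (x + 1)%R).+1) (f (redistribute eta x r) - f eta).

Definition monotone_fun (R : realType) N (f : config N -> R) : Prop :=
  forall eta xi : config N, (forall x, (eta x <= xi x)%N) -> f eta <= f xi.

Definition stochastically_le (R : realType) N
    (mu1 mu2 : probability (config N) R) : Prop :=
  forall f : config N -> R, bounded_fun (f : config N -> R^o) -> monotone_fun f ->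
    ('E_mu1[f] <= 'E_mu2[f])%E.

(* P t eta A is the probability of being in A at time t when starting from eta;
   only the times t >= 0 are meaningful. *)
Definition transition_family (R : realType) N :=
  R -> R.-pker (config N) ~> (config N).

Definition markov_semigroup (R : realType) N (P : transition_family R N) : Prop :=
  (forall eta A, P 0 eta A = \d_eta A) /\
  (forall s t : R, 0 <= s -> 0 <= t -> forall eta A,
     P (s + t) eta A = (\int[P s eta]_xi P t xi A)%E).

Definition semigroup_op (R : realType) N (P : transition_family R N) (t : R)
    (f : config N -> R) (eta : config N) : R :=
  \int[P t eta]_xi f xi.

(* Meant for operators with bounded jump rates, such as dKMP_generator (total
   rate at most N): all bounded functions are then in the domain, and the
   condition determines the semigroup. *)
Definition has_generator (R : realType) N (P : transition_family R N)
    (L : (config N -> R) -> config N -> R) : Prop :=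
  forall f : config N -> R, bounded_fun (f : config N -> R^o) ->
  forall eta : config N,
    (semigroup_op P t f eta - f eta) / t @[t --> 0^'+] --> L f eta.

Section law_at.
Context (R : realType) (N : nat).
Variables (P : transition_family R N) (t : R) (mu : probability (config N) R).

Definition law_at (A : set (config N)) : \bar R := (\int[mu]_eta P t eta A)%E.

Let law_at0 : law_at set0 = 0%E.
Proof.
rewrite /law_at (eq_integral (cst 0%E)) ?integral0// => eta _.
by rewrite measure0.
Qed.

Let law_at_ge0 A : (0 <= law_at A)%E.
Proof. exact: integral_ge0. Qed.

Let law_at_sigma_additive : semi_sigma_additive law_at.
Proof.
move=> U mU tU mUU; rewrite [X in _ --> X](_ : _ =
  (\int[mu]_eta (\sum_(n <oo) P t eta (U n)))%E); last first.
  apply: eq_integral => eta _.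
  by apply/esym/cvg_lim => //; exact/measure_semi_sigma_additive.
apply/cvg_closeP; split.
  by apply: is_cvg_nneseries => n _ _; exact: integral_ge0.
rewrite closeE// integral_nneseries// => n.
Qed.

HB.instance Definition _ := isMeasure.Build _ _ R
  law_at law_at0 law_at_ge0 law_at_sigma_additive.

Let law_at_setT : law_at setT = 1%E.
Proof.
rewrite /law_at (eq_integral (cst 1%E)); last by move=> eta _; rewrite prob_kernel.
rewrite integral_cst// mul1e.
exact: probability_setT.
Qed.

HB.instance Definition _ := Measure_isProbability.Build _ _ _ law_at law_at_setT.

End law_at.

Definition attractive (R : realType) N (P : transition_family R N) : Prop :=
  forall mu1 mu2 : probability (config N) R, stochastically_le mu1 mu2 ->
  forall t : R, 0 <= t -> stochastically_le (law_at P t mu1) (law_at P t mu2).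

(* Main.v *)
Require Import Defs.
From mathcomp Require Import all_boot all_order all_algebra.
From mathcomp Require Import all_classical all_reals all_analysis.
From mathcomp Require Import ring lra zify.

Set Implicit Arguments.
Unset Strict Implicit.
Unset Printing Implicit Defensive.

Import Order.TTheory GRing.Theory Num.Theory.
Import numFieldNormedType.Exports.

Local Open Scope classical_set_scope.
Local Open Scope ring_scope.

(** The generator is a sum over bonds of [A_x - 1], where [A_x f] is the average
    of [f] over the uniform splittings of the particles of the bond (x, x+1).
    Attractiveness rests on two facts.

    Monotonicity of one bond.  A uniform splitting of [n] particles can be
    turned into a uniform splitting of [n + 1] particles by adding the new
    particle to the left site, holding [r] particles, with probability
    [(r + 1) / (n + 2)], and to the right one otherwise.  This is a coupling
    which only adds particles, so averaging a monotone function over splittings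
    is monotone in [n] ([le_splitting_average]), and every [A_x] preserves
    monotone functions ([bond_average_monotone]).

    Passage to the semigroup.  The Euler step
    [1 + h L = (1 - #|T_N| h) + h * \sum_x A_x] has nonnegative coefficients
    when [#|T_N| h <= 1], so it preserves monotone functions, and sup bounds as
    well.  It remains to see that [(1 + (t/n) L)^n f] converges to [P_t f]
    pointwise ([euler_cvg]).  The generator conserves the number of particles,
    and only finitely many configurations have a given number [m] of them.  The
    pointwise derivative at time 0, applied to the finitely many indicators of
    such configurations and to the indicator of all the others, gives one
    quantity [one_step_error h], which is o(h) and bounds
    [|P_h g - (1 + h L) g| <= C * one_step_error h] on the mass shell
    simultaneously for all [g] bounded by [C] ([defect_le]).  Telescoping over
    [n] steps of length [t/n] costs [3 C n * one_step_error (t/n)]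
    ([euler_error]), which vanishes.  The factor 3 accounts for the mass that
    [P_h] may let escape from the shell, itself at most [one_step_error h].

    So [P_t f] is monotone when [f] is ([semigroup_op_monotone]), and
    integrating it against ordered initial laws concludes. *)

(** * Uniform splittings of a number of particles *)

(** This is the coupling of uniform splittings of [n] and [n.+1] particles with
    denominators cleared: on the left, the weight [n.+2] of each splitting
    [(r, n - r)] is shared between [(r, n.+1 - r)], with weight [n.+1 - r], and
    [(r.+1, n - r)], with weight [r.+1].  Collecting weights, each splitting of
    [n.+1] receives exactly [n.+1]. *)
Lemma sum_splitting_step (R : realFieldType) (G : nat -> nat -> R) (n : nat) :
  (forall a b a' b', (a <= a')%N -> (b <= b')%N -> G a b <= G a' b') ->
  n.+2%:R * (\sum_(r < n.+1) G r (n - r)%N) <=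
  n.+1%:R * (\sum_(r < n.+2) G r (n.+1 - r)%N).
Proof.
move=> Gmono.
have -> : n.+1%:R * (\sum_(r < n.+2) G r (n.+1 - r)%N) =
    \sum_(r < n.+1) ((n.+1 - r)%:R * G r (n.+1 - r)%N +
                     r.+1%:R * G r.+1 (n - r)%N).
  rewrite big_split /= mulr_sumr.
  have -> : \sum_(r < n.+1) (n.+1 - r)%:R * G r (n.+1 - r)%N =
            \sum_(r < n.+2) (n.+1 - r)%:R * G r (n.+1 - r)%N.
    by rewrite [RHS]big_ord_recr /= subnn mul0r addr0.
  have -> : \sum_(r < n.+1) r.+1%:R * G r.+1 (n - r)%N =
            \sum_(r < n.+2) r%:R * G r (n.+1 - r)%N.
    rewrite [RHS]big_ord_recl /= mul0r add0r.
    by apply: eq_bigr => i _; rewrite /bump /= add1n subSS.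
  rewrite -big_split; apply: eq_bigr => -[r /= rn] _.
  by rewrite -mulrDl -natrD subnK.
rewrite mulr_sumr; apply: ler_sum => -[r /= rn] _.
have -> : n.+2%:R = (n.+1 - r)%:R + r.+1%:R :> R.
  by rewrite -natrD; congr _%:R; lia.
rewrite mulrDl lerD // ler_wpM2l // Gmono //; lia.
Qed.

Lemma le_splitting_average (R : realFieldType) (G : nat -> nat -> R)
    (n m : nat) :
  (forall a b a' b', (a <= a')%N -> (b <= b')%N -> G a b <= G a' b') ->
  (n <= m)%N ->
  n.+1%:R^-1 * (\sum_(r < n.+1) G r (n - r)%N) <=
  m.+1%:R^-1 * (\sum_(r < m.+1) G r (m - r)%N).
Proof.
move=> Gmono; elim: m => [|m IH]; first by rewrite leqn0 => /eqP ->.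
rewrite leq_eqVlt => /predU1P[-> //|/IH/le_trans]; apply.
rewrite ler_pdivrMl ?ltr0n // mulrCA ler_pdivlMl ?ltr0n //.
exact: sum_splitting_step.
Qed.

(** * Bond averages and Euler steps of the generator *)

Section generator.
Context (R : realType) (N : nat).
Implicit Types (f g : config N -> R) (eta xi : config N) (x z : 'Z_N) (h C : R).

Definition bounded_by C f := forall eta, `|f eta| <= C.

Definition bond_average f x eta : R :=
  (eta x + eta (x + 1)%R).+1%:R^-1 *
  \sum_(r < (eta x + eta (x + 1)%R).+1) f (redistribute eta x r).

Lemma dKMP_generatorE f eta :
  dKMP_generator f eta =
  (\sum_x bond_average f x eta) - #|'Z_N|%:R * f eta.
Proof.
rewrite /dKMP_generator mulr_natl -sumr_const -sumrB; apply: eq_bigr => x _.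
rewrite big_split /= mulrDr; congr (_ + _).
rewrite sumr_const card_ord -[X in _ * X]mulr_natl mulrA mulVf ?mul1r //.
Qed.

(** Only the total content of the bond matters for its new content, so
    [le_splitting_average] applies to [f] with the other sites fixed. *)
Lemma bond_average_monotone f x :
  monotone_fun f -> monotone_fun (bond_average f x).
Proof.
move=> fmono eta xi le_eta_xi.
pose G a b := f [ffun z => if z == x then a else
                           if z == x + 1 then b else xi z].
have Gmono a b a' b' : (a <= a')%N -> (b <= b')%N -> G a b <= G a' b'.
  by move=> aa bb; apply: fmono => z; rewrite !ffunE; do 2 case: ifP => // _.
(* The sites outside the bond are raised first, then the content of the bond. *)
apply: le_trans (le_splitting_average Gmono _); last first.
  exact: leq_add (le_eta_xi x) (le_eta_xi (x + 1)).
rewrite ler_wpM2l ?invr_ge0 //; apply: ler_sum => r _; apply: fmono => z.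
by rewrite !ffunE; do 2 case: ifP => // _.
Qed.

Lemma bond_average_bounded C f x :
  bounded_by C f -> bounded_by C (bond_average f x).
Proof.
move=> fC eta; rewrite normrM ger0_norm ?invr_ge0 // ler_pdivrMl ?ltr0n //.
apply: le_trans (ler_norm_sum _ _ _) _.
apply: le_trans (ler_sum _ (fun i _ => fC _)) _.
by rewrite sumr_const card_ord mulr_natl.
Qed.

Definition euler_step h f eta : R := f eta + h * dKMP_generator f eta.

(** For [#|'Z_N|%:R * h <= 1] this exhibits the Euler step as a convex combination
    of the identity and the bond averages. *)
Lemma euler_stepE h f eta :
  euler_step h f eta =
  (1 - #|'Z_N|%:R * h) * f eta + h * \sum_x bond_average f x eta.
Proof. by rewrite /euler_step dKMP_generatorE; ring. Qed.

Lemma euler_step_monotone h f : 0 <= h -> #|'Z_N|%:R * h <= 1 ->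
  monotone_fun f -> monotone_fun (euler_step h f).
Proof.
move=> h0 h1 fmono eta xi le_eta_xi; rewrite !euler_stepE.
rewrite lerD // ler_wpM2l ?subr_ge0 //; first exact: fmono.
by apply: ler_sum => x _; exact: bond_average_monotone.
Qed.

Lemma euler_step_bounded C h f : 0 <= h -> #|'Z_N|%:R * h <= 1 ->
  bounded_by C f -> bounded_by C (euler_step h f).
Proof.
move=> h0 h1 fC eta; rewrite euler_stepE.
have -> : C = (1 - #|'Z_N|%:R * h) * C + h * \sum_(x : 'Z_N) C.
  by rewrite sumr_const -mulr_natl; ring.
apply: le_trans (ler_normD _ _) _; rewrite !normrM ger0_norm ?subr_ge0 //.
rewrite (ger0_norm h0) lerD // ler_wpM2l ?subr_ge0 //.
apply: le_trans (ler_norm_sum _ _ _) _.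
by apply: ler_sum => x _; exact: bond_average_bounded.
Qed.

Lemma iter_euler_monotone n h f : 0 <= h -> #|'Z_N|%:R * h <= 1 ->
  monotone_fun f -> monotone_fun (iter n (euler_step h) f).
Proof. by move=> h0 h1 fm; elim: n => //= n; exact: euler_step_monotone. Qed.

Lemma iter_euler_bounded C n h f : 0 <= h -> #|'Z_N|%:R * h <= 1 ->
  bounded_by C f -> bounded_by C (iter n (euler_step h) f).
Proof. by move=> h0 h1 fC; elim: n => //= n; exact: euler_step_bounded. Qed.

Lemma dKMP_generatorD f g eta :
  dKMP_generator (fun xi => f xi + g xi) eta =
  dKMP_generator f eta + dKMP_generator g eta.
Proof.
rewrite /dKMP_generator -big_split /=; apply: eq_bigr => x _.
rewrite -mulrDr -big_split /=; congr (_ * _); apply: eq_bigr => r _; ring.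
Qed.

Lemma dKMP_generatorZ c f eta :
  dKMP_generator (fun xi => c * f xi) eta = c * dKMP_generator f eta.
Proof.
rewrite /dKMP_generator mulr_sumr; apply: eq_bigr => x _.
rewrite mulrCA; congr (_ * _); rewrite mulr_sumr; apply: eq_bigr => r _.
by rewrite mulrBr.
Qed.

Definition mass eta : nat := \sum_z eta z.

Lemma mass_redistribute eta x r : (r <= eta x + eta (x + 1)%R)%N ->
  mass (redistribute eta x r) = mass eta.
Proof.
move=> rn; have xx1 : x + 1 != x.
  by rewrite -subr_eq0 addrC addKr oner_eq0.
rewrite /mass (bigD1 x) //= [in RHS](bigD1 x) //=.
rewrite (bigD1 (x + 1)) //= [in RHS](bigD1 (x + 1)) //=.
rewrite !ffunE eqxx (negbTE xx1) eqxx !addnA subnKC //; congr (_ + _)%N.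
by apply: eq_bigr => z /andP[/negbTE zx /negbTE zx1]; rewrite ffunE zx zx1.
Qed.

(** The moves conserve [mass], so the generator never looks outside the mass shell
    of the current configuration. *)
Lemma dKMP_generator_local f g eta :
  (forall xi, mass xi = mass eta -> f xi = g xi) ->
  dKMP_generator f eta = dKMP_generator g eta.
Proof.
move=> fg; apply: eq_bigr => x _; congr (_ * _); apply: eq_bigr => r _.
by rewrite (fg eta) // fg // mass_redistribute // -ltnS.
Qed.

Lemma finite_mass_shell (m : nat) :
  exists2 S : seq (config N), uniq S & forall eta, (eta \in S) = (mass eta == m).
Proof.
pose incl (e : {ffun 'Z_N -> 'I_m.+1}) : config N := [ffun z => nat_of_ord (e z)].
exists (undup [seq e <- map incl (enum {: {ffun 'Z_N -> 'I_m.+1}}) | mass e == m]).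
  exact: undup_uniq.
move=> eta; rewrite mem_undup mem_filter; case: eqP => //= etam.
(* Each site of a configuration of mass [m] holds at most [m] particles. *)
apply/mapP; exists [ffun z => inord (eta z)]; first by rewrite mem_enum.
apply/ffunP => z; rewrite !ffunE inordK // ltnS -etam /mass.
by rewrite (bigD1 z) //= leq_addr.
Qed.

End generator.

(** * Expectations of bounded functions *)

Section expectation.
Context (R : realType) (N : nat).
Implicit Types (f g : config N -> R) (C : R) (mu : probability (config N) R).
Implicit Types (nu : {measure set (config N) -> \bar R}).

Lemma bounded_fun_by f :
  bounded_fun (f : config N -> R^o) <-> exists C, bounded_by C f.
Proof.
split=> [[M [_ fM]]|[C fC]].
  exists (`|M| + 1) => eta; apply: fM => //.
  by rewrite ltr_pwDr // ler_norm.
exists C; split; first exact: num_real.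
by move=> y Cy eta _; exact: le_trans (fC eta) (ltW Cy).
Qed.

Lemma integrable_bounded nu C f :
  nu setT = 1%E -> bounded_by C f -> nu.-integrable setT (EFin \o f).
Proof.
move=> nu1 fC; apply: measurable_bounded_integrable => //.
  by rewrite nu1 ltry.
by apply/bounded_fun_by; exists C.
Qed.

Lemma Rintegral_bounded nu C f :
  nu setT = 1%E -> bounded_by C f -> `|\int[nu]_xi f xi| <= C.
Proof.
move=> nu1 fC; have fint := integrable_bounded nu1 fC.
apply: le_trans (le_normr_Rintegral measurableT fint) _.
have -> : C = \int[nu]_xi C by rewrite Rintegral_cst // nu1 mulr1.
apply: le_Rintegral => //.
- apply: (@integrable_bounded _ C) => // eta; by rewrite normr_id.
- by apply: (@integrable_bounded _ `|C|).
Qed.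

Lemma eq_Rintegral_measure nu1 nu2 f :
  (forall A, nu1 A = nu2 A) -> \int[nu1]_xi f xi = \int[nu2]_xi f xi.
Proof. by move=> nu12; congr fine; apply: eq_measure_integral. Qed.

(** The law at time [t] is the composition of the constant kernel [mu] with the
    transition kernel, so integrals against it are iterated integrals. *)
Lemma ge0_integral_law_at (P : transition_family R N) t mu
    (f : config N -> \bar R) : (forall eta, (0 <= f eta)%E) ->
  (\int[law_at P t mu]_xi f xi = \int[mu]_eta \int[P t eta]_xi f xi)%E.
Proof.
move=> f0; have mmu : measurable_fun [set: config N]
  (fun _ : config N => mu : pprobability _ R) by [].
have := @integral_kcomp _ _ _ _ _ _ R
  (kprobability mmu) (kernel.kernel_snd (P t)) point f f0.
by rewrite /kernel.kernel_snd /kprobability /= => <-.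
Qed.

(** Adding the constant [C] makes [f] nonnegative, where
    [ge0_integral_law_at] applies. *)
Lemma Rintegral_law_at (P : transition_family R N) t mu C f :
  bounded_by C f ->
  \int[law_at P t mu]_xi f xi = \int[mu]_eta semigroup_op P t f eta.
Proof.
move=> fC; have Cint nu : nu setT = 1%E -> nu.-integrable setT (EFin \o cst C).
  by move=> nu1; apply: (@integrable_bounded _ `|C|).
have kerT eta : P t eta setT = 1%E by exact: prob_kernel.
have muT : mu setT = 1%E by exact: probability_setT.
have lawT : law_at P t mu setT = 1%E by exact: probability_setT.
have fint := integrable_bounded _ fC.
have Pfint : mu.-integrable setT (EFin \o semigroup_op P t f).
  apply: (@integrable_bounded _ C) => // eta.
  exact: Rintegral_bounded.
(* Under a probability, [C] is the integral of the constant [C]. *)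
apply: (addIr C); rewrite -[in LHS](mulr1 C) -[X in _ * X]/(fine 1).
rewrite -lawT -Rintegral_cst // -RintegralD ?fint ?Cint //.
rewrite -[in RHS](mulr1 C) -[X in _ = _ + _ * X]/(fine 1).
rewrite -muT -Rintegral_cst // -RintegralD ?Cint //.
congr fine; rewrite ge0_integral_law_at; last first.
  by move=> eta; rewrite lee_fin -lerBlDr sub0r; case/ler_normlP: (fC eta); lra.
apply: eq_integral => eta _; rewrite /semigroup_op.
have -> : C = \int[P t eta]_xi C by rewrite Rintegral_cst // kerT mulr1.
rewrite -RintegralD ?fint ?Cint // Rintegral_cst // kerT mulr1 fineK //.
apply: integrable_fin_num => //; apply: (@integrable_bounded _ (C + `|C|)) => //.
by move=> xi; apply: le_trans (ler_normD _ _) _; rewrite lerD.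
Qed.

End expectation.

(** * The semigroup acting on bounded functions *)

Section semigroup.
Context (R : realType) (N : nat) (P : transition_family R N).
Hypothesis hP : markov_semigroup P.
Implicit Types (f g : config N -> R) (eta xi : config N) (s t c C D : R).

Let kerT t eta : P t eta setT = 1%E. Proof. exact: prob_kernel. Qed.

Lemma semigroup_op_bounded t C f :
  bounded_by C f -> bounded_by C (semigroup_op P t f).
Proof. by move=> fC eta; exact: Rintegral_bounded. Qed.

Lemma semigroup_opD t C D f g eta : bounded_by C f -> bounded_by D g ->
  semigroup_op P t (fun xi => f xi + g xi) eta =
  semigroup_op P t f eta + semigroup_op P t g eta.
Proof.
by move=> fC gD; apply: RintegralD => //;
  [exact: integrable_bounded fC | exact: integrable_bounded gD].
Qed.

Lemma semigroup_opZ t c C f eta : bounded_by C f ->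
  semigroup_op P t (fun xi => c * f xi) eta = c * semigroup_op P t f eta.
Proof.
by move=> fC; apply: RintegralZl => //; exact: integrable_bounded fC.
Qed.

Lemma semigroup_op_cst t c eta : semigroup_op P t (cst c) eta = c.
Proof. by rewrite /semigroup_op Rintegral_cst // kerT mulr1. Qed.

Lemma le_semigroup_op t C D f g eta : bounded_by C f -> bounded_by D g ->
  (forall xi, f xi <= g xi) ->
  semigroup_op P t f eta <= semigroup_op P t g eta.
Proof.
by move=> fC gD fg; apply: le_Rintegral => //;
  [exact: integrable_bounded fC | exact: integrable_bounded gD].
Qed.

(** The Chapman-Kolmogorov relation says that [P (s + t) eta] is the law at time
    [t] started from the law [P s eta]. *)
Lemma semigroup_op_comp s t C f eta : 0 <= s -> 0 <= t -> bounded_by C f ->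
  semigroup_op P (s + t) f eta = semigroup_op P s (semigroup_op P t f) eta.
Proof.
move=> s0 t0 fC; have [_ ck] := hP.
(* [law_at] starts from a probability; this one coincides with [P s eta]. *)
pose mu := law_at P s (\d_eta).
have muE A : mu A = P s eta A by rewrite /mu /law_at /= integral_dirac // diracT mul1e.
rewrite {2}/semigroup_op -(eq_Rintegral_measure _ muE) -(Rintegral_law_at _ _ _ fC).
apply: eq_Rintegral_measure => A; rewrite ck // /law_at /=.
by apply: eq_measure_integral.
Qed.

Lemma semigroup_op0 f eta : semigroup_op P 0 f eta = f eta.
Proof.
have [P0 _] := hP; rewrite /semigroup_op (eq_Rintegral_measure _ (P0 eta)).
by rewrite /Rintegral integral_dirac // diracT mul1e.
Qed.

End semigroup.

(** * Convergence of the Euler scheme *)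

Lemma cvg_sum0 (R : realType) (T I : Type) (F : set_system T) (r : seq I)
    (u : I -> T -> R) : Filter F -> (forall i, u i x @[x --> F] --> (0 : R)) ->
  \sum_(i <- r) u i x @[x --> F] --> (0 : R).
Proof.
move=> FF u0.
have := @cvg_big R I +%R 0 xpredT (@add_continuous _) T F r u (fun=> 0) FF.
by rewrite !big1_eq; apply.
Qed.

Section euler.
Context (R : realType) (N : nat) (P : transition_family R N).
Hypothesis hP : markov_semigroup P.
Hypothesis hL : has_generator P (@dKMP_generator R N).
Implicit Types (f g v w : config N -> R) (eta xi z : config N).
Implicit Types (s t h c C D : R) (S : seq (config N)).

Lemma normr_semigroup_op_le t D v w eta : bounded_by D v ->
  (forall xi, `|w xi| <= v xi) ->
  `|semigroup_op P t w eta| <= semigroup_op P t v eta.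
Proof.
move=> vD wv.
have wD : bounded_by D w.
  by move=> xi; apply: le_trans (wv xi) (le_trans (ler_norm _) (vD xi)).
rewrite ler_norml lerNl -mulN1r -(semigroup_opZ _ _ _ _ wD).
apply/andP; split; last first.
  by apply: le_semigroup_op wD vD _ => xi; exact: le_trans (ler_norm _) (wv xi).
apply: le_semigroup_op vD _; first by move=> xi; rewrite mulN1r normrN.
by move=> xi; rewrite mulN1r; apply: le_trans (wv xi); rewrite -normrN ler_norm.
Qed.

Definition defect h f eta : R := semigroup_op P h f eta - euler_step h f eta.

Lemma defectD h C D f g eta : bounded_by C f -> bounded_by D g ->
  defect h (fun xi => f xi + g xi) eta = defect h f eta + defect h g eta.
Proof.
move=> fC gD; rewrite /defect (semigroup_opD _ _ _ fC gD) /euler_step.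
by rewrite dKMP_generatorD; ring.
Qed.

Lemma defectZ h c C f eta : bounded_by C f ->
  defect h (fun xi => c * f xi) eta = c * defect h f eta.
Proof.
move=> fC; rewrite /defect (semigroup_opZ _ _ _ _ fC) /euler_step.
by rewrite dKMP_generatorZ; ring.
Qed.

Lemma bounded_indicator (p : pred (config N)) :
  bounded_by 1 (fun z => (p z)%:R : R).
Proof. by move=> z; case: (p z); rewrite ?normr1 ?normr0. Qed.

Lemma bounded_combination S (a : config N -> R) :
  bounded_by (\sum_(xi <- S) `|a xi|)
    (fun z => \sum_(xi <- S) a xi * (z == xi)%:R).
Proof.
move=> z; apply: le_trans (ler_norm_sum _ _ _) _; apply: ler_sum => xi _.
by rewrite normrM ler_piMr // bounded_indicator.
Qed.

(** Linearity reduces the defect of a finitely supported function to the defects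
    of indicators, which do not depend on the function. *)
Lemma defect_combination h S (a : config N -> R) eta :
  defect h (fun z => \sum_(xi <- S) a xi * (z == xi)%:R) eta =
  \sum_(xi <- S) a xi * defect h (fun z => (z == xi)%:R) eta.
Proof.
elim: S => [|xi S IH].
  rewrite big_nil -[RHS](mul0r (defect h (cst 0) eta)).
  rewrite -(@defectZ _ _ 0); last by move=> z; rewrite normr0.
  by congr defect; apply/funext => z; rewrite big_nil mul0r.
rewrite big_cons -IH -(defectZ _ _ _ (bounded_indicator (pred1 xi))).
rewrite -(@defectD _ `|a xi| (\sum_(xi <- S) `|a xi|)).
- by congr defect; apply/funext => z; rewrite big_cons.
- by move=> z; rewrite normrM ler_piMr // (bounded_indicator (pred1 xi)).
- exact: bounded_combination.
Qed.

Lemma defect_little_o C f eta : bounded_by C f ->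
  defect h f eta / h @[h --> 0^'+] --> (0 : R).
Proof.
move=> fC; have fb : bounded_fun (f : config N -> R^o).
  by apply: (bounded_fun_by f).2; exists C.
have := cvgB (@hL f fb eta) (cvg_cst (dKMP_generator f eta)).
rewrite subrr => lim0; refine (cvg_trans _ (lim0 _ _)); apply: near_eq_cvg.
near=> h; have h0 : h != 0 by rewrite gt_eqF //; near: h; exact: nbhs_right_gt.
rewrite /defect /euler_step !fctE /=; field.
Unshelve. all: by end_near. Qed.

Section mass_shell.
Variables (m : nat) (S : seq (config N)).
Hypothesis uS : uniq S.
Hypothesis memS : forall eta, (eta \in S) = (mass eta == m).

(** The indicators of the points of [S] span the functions carried by the mass
    shell [S]; the part of a bounded function outside [S] is dominated by the
    indicator of the complement, whose defect on [S] is the mass that [P h] lets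
    escape from [S]. *)
Definition one_step_error h : R := \sum_(eta <- S)
  ((\sum_(xi <- S) `|defect h (fun z => (z == xi)%:R) eta|) +
   `|defect h (fun z => (z \notin S)%:R) eta|).

Lemma one_step_error_ge0 h : 0 <= one_step_error h.
Proof.
by apply: sumr_ge0 => eta _; rewrite addr_ge0 // sumr_ge0.
Qed.

Lemma one_step_error_little_o :
  one_step_error h / h @[h --> 0^'+] --> (0 : R).
Proof.
have little_o (p : pred (config N)) eta :
    `|defect h (fun z => (p z)%:R) eta| / h @[h --> 0^'+] --> (0 : R).
  have := cvg_norm (defect_little_o eta (bounded_indicator p)).
  rewrite normr0 => lim0; refine (cvg_trans _ (lim0 _)); apply: near_eq_cvg; near=> h.
  by rewrite normrM normfV (gtr0_norm (_ : 0 < h)) //; near: h; exact: nbhs_right_gt.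
have -> : (fun h => one_step_error h / h) = (fun h => \sum_(eta <- S)
  ((\sum_(xi <- S) `|defect h (fun z => (z == xi)%:R) eta| / h) +
   `|defect h (fun z => (z \notin S)%:R) eta| / h)).
  apply/funext => h; rewrite /one_step_error mulr_suml.
  by apply: eq_bigr => eta _; rewrite mulrDl mulr_suml.
apply: cvg_sum0 => eta; rewrite -[X in _ --> X]addr0.
by apply: cvgD; [apply: cvg_sum0 => xi; exact: little_o (pred1 xi) _|exact: little_o].
Unshelve. all: by end_near. Qed.

(** One Euler step moves along bonds only, hence stays in the mass shell; [P h]
    is a priori only close to doing so. *)
Lemma euler_step_outside h g eta : eta \in S ->
  euler_step h (fun z => g z * (z \notin S)%:R) eta = 0.
Proof.
move=> etaS; rewrite /euler_step etaS mulr0 add0r.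
rewrite (@dKMP_generator_local _ _ _ (fun z => 0 * g z)).
  by rewrite dKMP_generatorZ mul0r mulr0.
by move=> xi xieta; rewrite memS xieta -memS etaS mulr0 mul0r.
Qed.

Lemma leak_defect h eta : eta \in S ->
  semigroup_op P h (fun z => (z \notin S)%:R) eta =
  defect h (fun z => (z \notin S)%:R) eta.
Proof.
move=> etaS; have := euler_step_outside h (cst 1) etaS.
by under eq_fun do rewrite mul1r; rewrite /defect => ->; rewrite subr0.
Qed.

Lemma one_step_error_ge_at h eta : eta \in S ->
  (\sum_(xi <- S) `|defect h (fun z => (z == xi)%:R) eta|) +
   `|defect h (fun z => (z \notin S)%:R) eta| <= one_step_error h.
Proof.
move=> etaS; rewrite /one_step_error [leRHS](bigD1_seq eta) //= lerDl.
by apply: sumr_ge0 => xi _; rewrite addr_ge0 // sumr_ge0.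
Qed.

Lemma leak_le h eta : eta \in S ->
  semigroup_op P h (fun z => (z \notin S)%:R) eta <= one_step_error h.
Proof.
move=> etaS; rewrite leak_defect //.
apply: le_trans (one_step_error_ge_at h etaS); apply: le_trans (ler_norm _) _.
by rewrite lerDr sumr_ge0.
Qed.

(** The estimate is uniform over all [g] bounded by [C]: this is what allows it to
    be applied to the iterates of the scheme, which change with [h].  It comes
    from expanding [g] along the indicators of the points of [S]. *)
Lemma defect_le h C g eta : bounded_by C g -> eta \in S ->
  `|defect h g eta| <= C * one_step_error h.
Proof.
move=> gC etaS; have C0 : 0 <= C by exact: le_trans (normr_ge0 _) (gC eta).
pose g_out z := g z * (z \notin S)%:R.
have g_outC : bounded_by C g_out.
  move=> z; rewrite normrM; apply: le_trans (gC z).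
  by rewrite ler_piMr // (bounded_indicator (fun z => z \notin S)).
have gE : g = fun z => (\sum_(xi <- S) g xi * (z == xi)%:R) + g_out z.
  apply/funext => z; rewrite /g_out; case: (boolP (z \in S)) => zS /=.
    rewrite mulr0 addr0 (bigD1_seq z) //= eqxx mulr1 big1 ?addr0 // => xi xiz.
    by rewrite eq_sym (negbTE xiz) mulr0.
  rewrite mulr1 big_seq big1 ?add0r // => xi xiS.
  by case: eqP zS xiS => [->/negP //|_ _ _]; rewrite mulr0.
rewrite [in defect _ _]gE (defectD _ _ (bounded_combination _ _) g_outC).
rewrite defect_combination.
apply: le_trans (ler_wpM2l C0 (one_step_error_ge_at h etaS)).
apply: le_trans (ler_normD _ _) _; rewrite mulrDr lerD //.
  apply: le_trans (ler_norm_sum _ _ _) _; rewrite mulr_sumr; apply: ler_sum => xi _.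
  by rewrite normrM ler_wpM2r.
rewrite {1}/defect euler_step_outside // subr0 -leak_defect //.
have leakC : bounded_by C (fun z => C * (z \notin S)%:R).
  move=> z; rewrite normrM (ger0_norm C0) ler_piMr //.
  exact: (bounded_indicator (fun z => z \notin S)).
apply: le_trans (normr_semigroup_op_le _ _ leakC _) _.
  by move=> z; rewrite normrM normr_nat ler_wpM2r.
rewrite (semigroup_opZ _ _ _ _ (bounded_indicator (fun z => z \notin S))).
by rewrite ler_wpM2l // ler_norm.
Qed.

(** The error propagates as
    [P_(n+1)h f - T^(n+1) f = P_h (P_nh f - T^n f) + (P_h - T) (T^n f)] with
    [T] the Euler step.  The induction hypothesis controls the argument of the
    first [P_h] only on [S]; outside, where that argument is at most [2 C], the
    probability of escaping from [S] takes over.  Each step thus costs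
    [2 C + C] times [one_step_error h]. *)
Lemma euler_error h C f n eta : 0 <= h -> #|'Z_N|%:R * h <= 1 ->
  bounded_by C f -> eta \in S ->
  `|semigroup_op P (n%:R * h) f eta - iter n (euler_step h) f eta| <=
  n%:R * (3 * C * one_step_error h).
Proof.
move=> h0 h1 fC; elim: n eta => [|n IH] eta etaS.
  by rewrite !mul0r semigroup_op0 // subrr normr0.
have C0 : 0 <= C by exact: le_trans (normr_ge0 _) (fC eta).
have e0 := one_step_error_ge0 h.
have nh0 : 0 <= n%:R * h by rewrite mulr_ge0.
pose A := n%:R * (3 * C * one_step_error h); have A0 : 0 <= A by rewrite !mulr_ge0.
pose u := semigroup_op P (n%:R * h) f.
pose v := iter n (euler_step h) f.
have uC : bounded_by C u by exact: semigroup_op_bounded.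
have vC : bounded_by C v by exact: iter_euler_bounded.
pose out z : R := (z \notin S)%:R.
have out1 : bounded_by 1 out by exact: bounded_indicator.
have -> : n.+1%:R * h = h + n%:R * h by rewrite -natr1 mulrDl mul1r addrC.
rewrite (semigroup_op_comp hP _ h0 nh0 fC) -/u iterS -/v.
have -> : semigroup_op P h u eta - euler_step h v eta =
          semigroup_op P h (fun z => u z + -1 * v z) eta + defect h v eta.
  have NvC : bounded_by C (fun z => -1 * v z) by move=> z; rewrite mulN1r normrN.
  rewrite (semigroup_opD _ _ _ uC NvC) (semigroup_opZ _ _ _ _ vC) /defect; ring.
apply: le_trans (ler_normD _ _) _.
have -> : n.+1%:R * (3 * C * one_step_error h) =
    (A + 2 * C * one_step_error h) + C * one_step_error h.
  by rewrite /A -natr1; ring.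
apply: lerD; last exact: defect_le.
have outC : bounded_by (2 * C) (fun z => 2 * C * out z).
  by move=> z; rewrite normrM ger0_norm ?mulr_ge0 // ler_piMr ?mulr_ge0.
have AC : bounded_by A (cst A : config N -> R) by move=> z; rewrite ger0_norm.
have AoutC : bounded_by (A + 2 * C) (fun z => cst A z + 2 * C * out z).
  by move=> z; apply: le_trans (ler_normD _ _) _; rewrite lerD ?AC ?outC.
apply: le_trans (normr_semigroup_op_le _ _ AoutC _) _.
  move=> z; rewrite mulN1r /out /=; case: (boolP (z \in S)) => zS /=.
    by rewrite mulr0 addr0; exact: IH.
  rewrite mulr1; apply: le_trans (ler_normB _ _) _.
  by have := uC z; have := vC z; lra.
rewrite (semigroup_opD _ _ _ AC outC) semigroup_op_cst (semigroup_opZ _ _ _ _ out1).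
by rewrite lerD2l ler_wpM2l ?mulr_ge0 // leak_le.
Qed.

End mass_shell.

Lemma cvg_step t : t / n.+1%:R @[n --> \oo] --> (0 : R).
Proof. by rewrite -(mulr0 t); apply: cvgMl_tmp; exact: cvg_harmonic. Qed.

Lemma step_small t : \forall n \near \oo, #|'Z_N|%:R * (t / n.+1%:R) <= 1.
Proof.
apply: (cvgr_le (#|'Z_N|%:R * 0)); last by rewrite mulr0.
by apply: cvgMl_tmp; exact: cvg_step.
Qed.

(** The error [n * o(t/n)] of [euler_error] vanishes.  The scheme is indexed by
    [n.+1] to keep the step [t / n.+1] meaningful. *)
Lemma euler_cvg t C f eta : 0 < t -> bounded_by C f ->
  iter n.+1 (euler_step (t / n.+1%:R)) f eta @[n --> \oo] -->
  semigroup_op P t f eta.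
Proof.
move=> t0 fC; have [S uS memS] := finite_mass_shell N (mass eta).
have etaS : eta \in S by rewrite memS eqxx.
have step_right : t / n.+1%:R @[n --> \oo] --> (0 : R)^'+.
  move=> A A0; have /(cvg_step t) stepA : nbhs (0 : R) (fun h => 0 < h -> A h) := A0.
  suff : \forall n \near \oo, A (t / n.+1%:R) by [].
  have : \forall n \near \oo, 0 < t / n.+1%:R -> A (t / n.+1%:R) := stepA.
  by apply: filterS => n; apply; rewrite divr_gt0.
have err0 : 3 * C * t * (one_step_error S (t / n.+1%:R) / (t / n.+1%:R))
    @[n --> \oo] --> (0 : R).
  rewrite -(mulr0 (3 * C * t)); apply: cvgMl_tmp.
  exact: cvg_comp step_right (one_step_error_little_o _).
apply/cvgrPdist_le => e e0; near=> n.
have n0 : n.+1%:R != 0 :> R by rewrite pnatr_eq0.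
have tE : t = n.+1%:R * (t / n.+1%:R) by rewrite mulrC divfK.
have scale k E : k != 0 -> k * (3 * C * E) = 3 * C * t * (E / (t / k)).
  by move=> k0; field; rewrite k0 gt_eqF.
rewrite [in semigroup_op _ _]tE.
apply: le_trans (euler_error uS memS _ _ _ fC etaS) _.
- by rewrite divr_ge0 // ltW.
- by near: n; exact: step_small.
- rewrite scale //.
  by near: n; exact: (cvgr_le 0).
Unshelve. all: by end_near. Qed.

Lemma semigroup_op_monotone t C f : 0 <= t -> bounded_by C f ->
  monotone_fun f -> monotone_fun (semigroup_op P t f).
Proof.
rewrite le_eqVlt => /predU1P[<- fC fmono eta xi le_eta_xi|t0 fC fmono eta xi le_eta_xi].
  by rewrite !semigroup_op0 //; exact: fmono.
apply: (ler_cvg_to (@euler_cvg _ _ _ eta t0 fC) (@euler_cvg _ _ _ xi t0 fC)).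
near=> n; apply: iter_euler_monotone => //; first by rewrite divr_ge0 // ltW.
by near: n; exact: step_small.
Unshelve. all: by end_near. Qed.

End euler.

(** * Attractiveness *)

Theorem theorem3p4 (R : realType) (N : nat) (hN : (2 <= N)%N)
    (P : transition_family R N) (hP : markov_semigroup P)
    (hL : has_generator P (@dKMP_generator R N)) :
  attractive P.
Proof.
move=> mu1 mu2 le_mu t t0 f fb fmono; have [C fC] := (bounded_fun_by f).1 fb.
have PfC : bounded_by C (semigroup_op P t f) by exact: semigroup_op_bounded.
have := le_mu _ ((bounded_fun_by _).2 (ex_intro _ C PfC))
  (semigroup_op_monotone hP hL t0 fC fmono).
have lawE mu : ('E_(law_at P t mu)[f] = 'E_mu[semigroup_op P t f])%E.
  have fint := integrable_fin_num measurableT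
    (integrable_bounded (probability_setT (law_at P t mu)) fC).
  have Pfint := integrable_fin_num measurableT
    (integrable_bounded (probability_setT mu) PfC).
  rewrite unlock -[LHS](fineK fint) -[RHS](fineK Pfint).
  by congr EFin; exact: Rintegral_law_at fC.
by rewrite !lawE.
Qed.
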